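(* Let $G$ be a modular abelian independence group. Suppose that $A, S, R$ are nonempty flats of $G$, all three of finite rank. Assume that $1\in R$ and $SR\subseteq A$. Then there exist nonempty flats $S', R'$ of $G$, both of finite rank, such that the following four conditions hold: (i) $S\subseteq S'R'\subseteq \operatorname{cl}(SR)\subseteq A$, (ii) $1\in R'\subseteq R$, (iii) $\rho(S')+\rho(R')=\rho(S)+\rho(R)$, (iv) $S'R'=S'\subseteq A$.
   Context: A finitary matroid is a pair $(E,\mathcal{I})$ consisting of a set $E$ and a nonempty collection $\mathcal{I}$ of subsets of $E$ (called the independent sets) such that: (I1) if $A\in\mathcal{I}$ and $B\subseteq A$ then $B\in\mathcal{I}$; (I2) if $A,B$ are finite elements of $\mathcal{I}$ with $|B|=|A|+1$, then there is $x\in B\setminus A$ with $\{x\}\cup A\in\mathcal{I}$; (I3) if $A\subseteq E$ and every finite subset of $A$ belongs to $\mathcal{I}$, then $A\in\mathcal{I}$. The collection $\mathcal{I}$ is called an independence structure on $E$. A basis of a subset $A\subseteq E$ is an inclusion-maximal independent subset of $A$; any two bases of $A$ have the same cardinality, and the rank $\rho(A)$ is that cardinal number; $A$ has finite rank if $\rho(A)$ is a nonnegative integer. An element $x\in E$ depends on $A\subseteq E$ if either $x\in A$, or $x\notin A$ and $\{x\}\cup B\notin\mathcal{I}$ for some independent $B\subseteq A$. The closure is $\operatorname{cl}(A)=\{x\in E: x\text{ depends on }A\}$, and $A$ is a flat if $\operatorname{cl}(A)=A$. The finitary matroid is modular if $\rho(A)+\rho(B)=\rho(A\cup B)+\rho(A\cap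 B)$ (as cardinals) for all flats $A,B$. An independence group is a group $G$ (written multiplicatively, with identity $1$) together with an independence structure $\mathcal{I}$ on the set $G$ such that for every $g\in G$ and $A\subseteq G$ one has $gA\in\mathcal{I}$ if and only if $A\in\mathcal{I}$, where $gA=\{gx:x\in A\}$. A modular abelian independence group is an independence group that is modular as a finitary matroid and whose group is abelian. For $X,Y\subseteq G$, $XY=\{xy:x\in X,y\in Y\}$. *)

(* Defs.v *)
From HB Require Import structures.
From mathcomp Require Import all_boot all_classical.

Set Implicit Arguments.
Unset Strict Implicit.
Unset Printing Implicit Defensive.

Local Open Scope classical_set_scope.
Local Open Scope card_scope.
Local Open Scope group_scope.

(* Sums of cardinals, cardinals being represented by sets up to [#=]. *)
Definition cardinal_sum (T U : Type) (A : set T) (B : set U) : set (T + U) :=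
  (inl @` A) `|` (inr @` B).

Section FinitaryMatroid.
Variable E : Type.

(* The whole type [E] is the ground set.  In (I2), [A] and [B] are finite with
   |A| = n and |B| = n + 1; (I3) concerns arbitrary, possibly infinite, [A]. *)
Record independence_structure (I : set (set E)) : Prop := {
  indep_nonempty : I !=set0 ;
  indep_sub : forall A B : set E, I A -> B `<=` A -> I B ;
  indep_exchange : forall (n : nat) (A B : set E), I A -> I B ->
    A #= `I_n -> B #= `I_n.+1 ->
    exists x : E, (B `\` A) x /\ I ([set x] `|` A) ;
  indep_finitary : forall A : set E,
    (forall F : set E, finite_set F -> F `<=` A -> I F) -> I A
}.

Variable I : set (set E).

Definition basis (A B : set E) : Prop :=
  [/\ I B, B `<=` A & forall C : set E, I C -> C `<=` A -> B `<=` C -> C = B].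

(* The cardinal rho(A), represented by a chosen basis of [A].  For an
   independence structure every [A] has a basis (Zorn and (I3)), so the default
   value is never used, and any two bases are equipotent, so that the choice is
   immaterial up to [#=]. *)
Definition rank (A : set E) : set E := xget set0 (basis A).

Definition finite_rank (A : set E) : Prop := finite_set (rank A).

Definition depends (x : E) (A : set E) : Prop :=
  A x \/
  (~ A x /\ exists B : set E, [/\ I B, B `<=` A & ~ I ([set x] `|` B)]).

Definition cl (A : set E) : set E := [set x | depends x A].

Definition flat (A : set E) : Prop := cl A = A.

Definition modular : Prop :=
  forall A B : set E, flat A -> flat B ->
    cardinal_sum (rank A) (rank B) #= cardinal_sum (rank (A `|` B)) (rank (A `&` B)).

End FinitaryMatroid.

Section IndependenceGroup.
Variable G : groupType.

Definition translate (g : G) (A : set G) : set G := [set g * x | x in A].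

Definition setprod (X Y : set G) : set G := [set x * y | x in X & y in Y].

Record independence_group (I : set (set G)) : Prop := {
  indep_group_structure : independence_structure I ;
  indep_group_translate : forall (g : G) (A : set G), I (translate g A) <-> I A
}.

Record modular_abelian_independence_group (I : set (set G)) : Prop := {
  maig_group : independence_group I ;
  maig_modular : modular I ;
  maig_abelian : forall x y : G, commute x y
}.

End IndependenceGroup.

(* Main.v *)
Require Import Defs.
From mathcomp Require Import all_boot all_classical finmap.

Set Implicit Arguments.
Unset Strict Implicit.
Unset Printing Implicit Defensive.

Local Open Scope classical_set_scope.
Local Open Scope card_scope.
Local Open Scope group_scope.

(** The pair (S', R') is obtained by iterating a closed form of Dyson's
    e-transform from additive number theory.  For e in S put

      S1 = cl (S U eR)   and   R1 = R n e^-1 S.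

    Everything that the theorem asks for, except S' R' = S', holds for one such
    step.  A product in (S U eR) R1 is either s r with s in S and r in R, or
    (e r) y = (e y) r with r in R and e y in S, by commutativity; so it lies in
    S R.  Multiplication by a fixed element commutes with the closure, hence
    S1 R1 is contained in cl (S R) ([dyson_setprod]).  As e R1 = S n eR and
    the rank is invariant under closure and translation, modularity for
    the flats S and eR says precisely that the sum of the two ranks is preserved
    ([dyson_rank]).  Finally 1 belongs to R1 because e belongs to S.

    If some e in S satisfies eR not contained in S, then R1 is a flat properly
    contained in R, so its rank is smaller ([rank_flat_proper]), and induction
    on the rank of R applies ([dyson_stabilize]).  Otherwise S R is contained in
    S, hence equal to S as 1 is in R, and the process stops.

    The matroid facts behind this are the extension of independent sets to
    bases, by Zorn's lemma ([basis_extend]), the comparison of an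
    independent set with a finite basis ([indep_card_le]), and that a basis of a
    set of finite rank remains a basis of its closure ([basis_cl]), which makes
    this closure a flat of the same rank. *)

(** * Cardinalities *)

Lemma cardinal_sum_congr (T T' U U' : Type) (A : set T) (A' : set T')
    (B : set U) (B' : set U') :
  A #= A' -> B #= B' -> cardinal_sum A B #= cardinal_sum A' B'.
Proof.
(* Option-valued bijections exist without a default point in the target. *)
have option_bij (V V' : Type) (C : set V) (C' : set V') : C #= C' ->
    exists f : V -> option V', set_bij C (some @` C') f.
  by move=> /ocard_eqP[f]; exists f.
move=> /option_bij[f [fS finj fsurj]] /option_bij[g [gS ginj gsurj]].
pose h (z : T + U) : option (T' + U') :=
  match z with inl x => omap inl (f x) | inr y => omap inr (g y) end.
have hbij : set_bij (cardinal_sum A B) (some @` cardinal_sum A' B') h.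
  split.
  - move=> _ [[x Ax <-]|[y By <-]] /=.
      by have [x' A'x' <-] := fS _ Ax; exists (inl x') => //; left; exists x'.
    by have [y' B'y' <-] := gS _ By; exists (inr y') => //; right; exists y'.
  - move=> z1 z2 /set_mem[[x1 A1 <-]|[y1 B1 <-]] /set_mem[[x2 A2 <-]|[y2 B2 <-]] /=.
    + have [[a1 _ e1] [a2 _ e2]] := (fS _ A1, fS _ A2).
      rewrite -e1 -e2 => -[a12]; congr inl.
      by apply: finj; [exact: mem_set | exact: mem_set | rewrite -e1 -e2 a12].
    + by have [[a1 _ <-] [a2 _ <-]] := (fS _ A1, gS _ B2).
    + by have [[a1 _ <-] [a2 _ <-]] := (gS _ B1, fS _ A2).
    + have [[a1 _ e1] [a2 _ e2]] := (gS _ B1, gS _ B2).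
      rewrite -e1 -e2 => -[a12]; congr inr.
      by apply: ginj; [exact: mem_set | exact: mem_set | rewrite -e1 -e2 a12].
  - move=> _ [_ [[x' A'x' <-]|[y' B'y' <-]] <-].
      have [|x Ax fx] := fsurj (Some x'); first by exists x'.
      by exists (inl x); [left; exists x | rewrite /= fx].
    have [|y By gy] := gsurj (Some y'); first by exists y'.
    by exists (inr y); [right; exists y | rewrite /= gy].
by apply/ocard_eqP; have [k _] := Pbij hbij; squash k.
Qed.

(** Infinite [D] are included: this produces an independent set of the exact
    size required by the exchange axiom inside one that is merely too large. *)
Lemma card_le_or_gt (T : Type) (D : set T) (n : nat) :
  D #<= `I_n \/ `I_n.+1 #<= D.
Proof.
have [/finite_setP[m Dm]|/infiniteP natD] := pselect (finite_set D).
  rewrite (card_le_eql Dm) (card_le_eqr Dm) !card_le_II.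
  by case: leqP => _; [left | right].
by right; apply: card_le_trans natD; apply: subset_card_le.
Qed.

Lemma card_setU1 (T : Type) (B : set T) (x : T) (n : nat) :
  ~ B x -> B #= `I_n -> [set x] `|` B #= `I_n.+1.
Proof.
elim/Pchoice: T => T in B x *.
move=> Bx Bn; have /finite_fsetP[X BX] : finite_set B by exists n.
have -> : [set x] `|` B = [set` (x |` X)%fset].
  by rewrite BX set_fsetU1.
apply/card_eq_fsetP; rewrite cardfsU1.
move: Bx Bn; rewrite BX => /= /negP -> /card_eq_fsetP ->.
by rewrite add1n.
Qed.


(** * Bases and closures in finite rank *)

(** A chain is directed, so that finitely many of its members are all contained
    in the largest of them: this is what makes independence, a property of
    finite character, pass to unions of chains. *)
Lemma finite_sub_chain (T : Type) (F : set (set T)) (K : set T) :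
  F !=set0 -> total_on F subset -> finite_set K ->
  K `<=` \bigcup_(D in F) D -> exists2 D, F D & K `<=` D.
Proof.
elim/Pchoice: T => T in F K *.
move=> [D0 FD0] totF /finite_fsetP[X ->] XF.
suff [D FD sD] : exists2 D, F D & forall x, x \in enum_fset X -> D x by exists D.
have : forall x, x \in enum_fset X -> (\bigcup_(D in F) D) x by [].
elim: (enum_fset X) => [_|y s IHs sF]; first by exists D0.
have [|D FD sD] := IHs; first by move=> x xs; apply: sF; rewrite inE xs orbT.
have [D' FD' D'y] : (\bigcup_(D in F) D) y by apply: sF; rewrite inE eqxx.
have [DD'|D'D] := totF _ _ FD FD'.
  by exists D' => // x; rewrite inE => /orP[/eqP->//|/sD /DD'].
by exists D => // x; rewrite inE => /orP[/eqP->|/sD//]; apply: D'D.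
Qed.

Section FiniteRank.
Variables (E : Type) (I : set (set E)).
Hypothesis indI : independence_structure I.
Implicit Types (A B C D X Y : set E) (x : E).

(** Zorn's lemma applied to the sets [D] with [C `|` D] independent, rather than
    to the independent sets containing [C], so that the empty chain has
    an upper bound as well. *)
Lemma basis_extend X C : I C -> C `<=` X -> exists2 B, basis I X B & C `<=` B.
Proof.
move=> IC CX; pose P D := I (C `|` D) /\ D `<=` X.
have [F FP totF|B [[IB BX] maxB]] := @Zorn_bigcup E P.
  split; last by apply: bigcup_sub => D /FP[].
  have [->|/set0P[D0 FD0]] := eqVneq F set0; first by rewrite bigcup_set0 setU0.
  apply: (indep_finitary indI) => K finK KF.
  have [|||_ [D FD <-] KD] := @finite_sub_chain _ [set C `|` D | D in F] K _ _ finK.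
  - by exists (C `|` D0), D0.
  - move=> _ _ [D FD <-] [D' FD' <-].
    by have [DD'|DD'] := totF _ _ FD FD'; [left|right]; apply: setUS.
  - move=> x /KF[Cx|[D FD Dx]]; last by exists (C `|` D); [exists D | right].
    by exists (C `|` D0); [exists D0 | left].
  - by apply: (indep_sub indI) KD; have [] := FP _ FD.
exists (C `|` B); last by left.
split=> // [|D ID DX CBD]; first by rewrite subUset.
apply/seteqP; split=> // x Dx; apply: contrapT => CBx.
apply: (maxB D); last first.
  have CD : C `<=` D by move=> y Cy; apply: CBD; left.
  by split=> //; rewrite setUidr.
split=> [y By|]; first by apply: CBD; right.
by move=> /(_ x Dx) Bx; apply: CBx; right.
Qed.

Lemma indep0 : I set0.
Proof. by have [A IA] := indep_nonempty indI; apply: (indep_sub indI) IA _. Qed.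

Lemma rank_basis X : basis I X (rank I X).
Proof.
by have [B XB _] := basis_extend indep0 (@sub0set _ X); apply: xgetPex; exists B.
Qed.

(** The exchange axiom without the size constraint [#|B| = #|A| + 1]: restrict
    [B] to a subset of the right size. *)
Lemma indep_augment A B : I A -> I B -> finite_set A -> ~ (B #<= A) ->
  exists x, (B `\` A) x /\ I ([set x] `|` A).
Proof.
move=> IA IB /finite_setP[n An]; rewrite (card_le_eqr An) => BA.
have [//|/card_subP[C CB CsubB]] := card_le_or_gt B n.
have [x [[Cx Ax] IxA]] :=
  indep_exchange indI IA (indep_sub indI IB CsubB) An CB.
by exists x; split=> //; split=> //; apply: CsubB.
Qed.

Lemma basis_dep X B x : basis I X B -> X x -> ~ B x -> ~ I ([set x] `|` B).
Proof.
move=> [IB BX maxB] Xx Bx IxB; apply: Bx.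
have <- : [set x] `|` B = B; last by left.
by apply: maxB => // y [->|/BX].
Qed.

(** A larger independent subset of [X] would augment [B] within [X], against the
    maximality of [B]. *)
Lemma indep_card_le X B D : basis I X B -> finite_set B -> I D -> D `<=` X ->
  D #<= B.
Proof.
move=> XB finB ID DX; apply/negP => /negP DB.
have [IB _ _] := XB.
have [x [[Dx Bx]]] := indep_augment IB ID finB (negP DB).
exact: basis_dep XB (DX _ Dx) Bx.
Qed.

Lemma finite_rankP X B : basis I X B -> finite_rank I X <-> finite_set B.
Proof.
move=> XB; have Xr := rank_basis X.
split=> fin; [have [IB BX _] := XB | have [IB BX _] := Xr];
  exact: card_le_finite (indep_card_le _ fin IB BX) fin.
Qed.

Lemma basis_card_rank X B : basis I X B -> finite_rank I X -> rank I X #= B.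
Proof.
move=> XB finX; have Xr := rank_basis X; apply: Cantor_Bernstein.
  have [Ir rX _] := Xr; apply: (indep_card_le XB) => //.
  exact/(finite_rankP XB).
by have [IB BX _] := XB; apply: (indep_card_le Xr).
Qed.

Lemma finite_rank_sub X Y : X `<=` Y -> finite_rank I Y -> finite_rank I X.
Proof.
move=> XY finY; have [Ir rX _] := rank_basis X.
apply: card_le_finite (finY); apply: (indep_card_le (rank_basis Y)) => //.
exact: subset_trans XY.
Qed.

Lemma sub_cl X : X `<=` cl I X.
Proof. by left. Qed.

Lemma cl_sub X Y : X `<=` Y -> cl I X `<=` cl I Y.
Proof.
move=> XY x [/XY|[Xx [B [IB BX IxB]]]]; first by left.
have [Yx|Yx] := pselect (Y x); [by left | right; split=> //].
by exists B; split=> //; apply: subset_trans XY.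
Qed.

Lemma flatI X Y : flat I X -> flat I Y -> flat I (X `&` Y).
Proof.
move=> flX flY; apply/seteqP; split; last exact: sub_cl.
move=> x clx; rewrite -flX -flY; split;
  by apply: cl_sub clx => ? [].
Qed.

(** Dependence on [X] is witnessed by an arbitrary independent subset [C] of [X];
    any basis [B] of [X] is a witness too.  Otherwise [[set x] `|` B] is
    independent and has one element more than a basis [D] containing [C], so it
    augments [D]: by [x], which contradicts the dependence on [C], or by an
    element of [X], which contradicts the maximality of [D]. *)
Lemma depends_basis X B x : basis I X B -> finite_rank I X ->
  cl I X x -> ~ X x -> ~ I ([set x] `|` B).
Proof.
move=> XB finX [//|[Xx [C [IC CX IxC]]]] _ IxB.
have [IB BX _] := XB.
have [n Bn] : finite_set B by apply/(finite_rankP XB).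
have [D XD CD] := basis_extend IC CX; have [ID DX _] := XD.
have Dn : D #= `I_n.
  by rewrite -(card_eql (basis_card_rank XD finX)) (card_eql (basis_card_rank XB finX)).
have xBn := card_setU1 (contra_not (BX x) Xx) Bn.
have [||y [[[->|By] Dy] IyD]] := indep_augment ID IxB.
- by exists n.
- by rewrite (card_le_eql xBn) (card_le_eqr Dn) card_le_II ltnn.
- by apply: IxC; apply: (indep_sub indI) IyD _; apply: setUS.
- exact: basis_dep XD (BX _ By) Dy IyD.
Qed.

Lemma basis_cl X B : basis I X B -> finite_rank I X -> basis I (cl I X) B.
Proof.
move=> XB finX; have [IB BX _] := XB.
split=> // [|C IC CX BC]; first by move=> x /BX; left.
apply/seteqP; split=> // x Cx; apply: contrapT => Bx.
have IxB : I ([set x] `|` B).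
  by apply: (indep_sub indI) IC _ => y [->|/BC].
have [Xx|Xx] := pselect (X x); first exact: basis_dep XB Xx Bx IxB.
exact: depends_basis XB finX (CX _ Cx) Xx IxB.
Qed.

Lemma finite_rank_cl X : finite_rank I X -> finite_rank I (cl I X).
Proof.
by move=> finX; apply/(finite_rankP (basis_cl (rank_basis X) finX)); exact: finX.
Qed.

Lemma rank_cl X : finite_rank I X -> rank I (cl I X) #= rank I X.
Proof.
move=> finX; apply: basis_card_rank; last exact: finite_rank_cl.
exact: basis_cl (rank_basis X) finX.
Qed.

(** [X] and [cl I X] share a basis, and it decides dependence on both. *)
Lemma flat_cl X : finite_rank I X -> flat I (cl I X).
Proof.
move=> finX; apply/seteqP; split; last exact: sub_cl.
move=> x clx; have [//|nclx] := pselect (cl I X x).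
have [Ir rX _] := rank_basis X.
have := depends_basis (basis_cl (rank_basis X) finX) (finite_rank_cl finX) clx nclx.
by move=> dep; right; split; [move=> /sub_cl | exists (rank I X)].
Qed.

(** A basis of [X] extended by an element of [Y] outside the flat [X] is still
    independent. *)
Lemma rank_flat_proper X Y (m n : nat) : flat I X -> X `<=` Y -> X <> Y ->
  rank I X #= `I_m -> rank I Y #= `I_n -> (m < n)%N.
Proof.
move=> flX XY neXY Xm Yn.
have [x Yx Xx] : exists2 x, Y x & ~ X x.
  apply: contrapT => noX; apply: neXY; apply/seteqP; split=> // x Yx.
  by apply: contrapT => Xx; apply: noX; exists x.
have [Ir rX _] := rank_basis X.
have Ixr : I ([set x] `|` rank I X).
  apply: contrapT => dep; apply: Xx; rewrite -flX.
  by have [?|?] := pselect (X x); [left | right; split=> //; exists (rank I X)].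
have xm := card_setU1 (contra_not (rX x) Xx) Xm.
rewrite -card_le_II -(card_le_eql xm) -(card_le_eqr Yn).
apply: (indep_card_le (rank_basis Y)) => //; first by exists n.
by move=> y [->//|/rX/XY].
Qed.

End FiniteRank.

(** * Invariance under translation *)

Section Translates.
Variables (G : groupType) (I : set (set G)).
Hypothesis indG : independence_group I.
Let indI : independence_structure I := indep_group_structure indG.
Implicit Types (X Y B : set G) (g x : G).

Lemma translateP g X x : translate g X x <-> X (g^-1 * x).
Proof.
split=> [[y Xy <-]|Xx]; first by rewrite mulKg.
by exists (g^-1 * x); rewrite ?mulVKg.
Qed.

Lemma translateK g X : translate g^-1 (translate g X) = X.
Proof. by apply/seteqP; split=> x; rewrite !translateP invgK mulKg. Qed.

Lemma translateU1 g x X :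
  translate g ([set x] `|` X) = [set g * x] `|` translate g X.
Proof. by rewrite /translate image_setU image_set1. Qed.

Lemma translate_cl_sub g X x : cl I X x -> cl I (translate g X) (g * x).
Proof.
move=> [Xx|[Xx [B [IB BX IxB]]]]; first by left; exists x.
right; split; first by rewrite translateP mulKg.
exists (translate g B); split; first exact/(indep_group_translate indG).
  exact: image_subset.
by rewrite -translateU1 => /(indep_group_translate indG).
Qed.

Lemma flat_translate g X : flat I X -> flat I (translate g X).
Proof.
move=> flX; apply/seteqP; split; last exact: sub_cl.
move=> x clx; apply/translateP; rewrite -flX -(translateK g X).
exact: translate_cl_sub.
Qed.

Lemma basis_translate g X B :
  basis I X B -> basis I (translate g X) (translate g B).
Proof.
move=> [IB BX maxB]; split; first exact/(indep_group_translate indG).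
  exact: image_subset.
move=> C IC CX BC; rewrite -(maxB (translate g^-1 C)).
- by rewrite -{1}(invgK g) translateK.
- exact/(indep_group_translate indG).
- by rewrite -(translateK g X); apply: image_subset.
- by rewrite -(translateK g B); apply: image_subset.
Qed.

Lemma card_translate g X : translate g X #= X.
Proof. by apply: inj_card_eq => x y _ _ /mulgI. Qed.

Lemma finite_rank_translate g X : finite_rank I X -> finite_rank I (translate g X).
Proof.
move=> finX; apply/(finite_rankP indI (basis_translate g (rank_basis indI X))).
exact: finite_image.
Qed.

Lemma rank_translate g X : finite_rank I X ->
  rank I (translate g X) #= rank I X.
Proof.
move=> finX; rewrite -(card_eqr (card_translate g (rank I X))).
apply: (basis_card_rank indI); last exact: finite_rank_translate.
exact: basis_translate (rank_basis indI X).
Qed.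

End Translates.

(** * The closed Dyson transform *)

Section DysonTransform.
Variables (G : groupType) (I : set (set G)).
Hypothesis modG : modular_abelian_independence_group I.
Let indG : independence_group I := maig_group modG.
Let indI : independence_structure I := indep_group_structure indG.
Let mulC (x y : G) : x * y = y * x := maig_abelian modG x y.
Implicit Types (X Y S R : set G) (e g x : G).

(** For each [y] in [Y], translation by [y] maps [cl I X] into the closure of
    the translate of [X], which lies in [cl I (cl I Z) = cl I Z]. *)
Lemma setprod_cl_sub X Y Z : setprod X Y `<=` cl I Z -> finite_rank I Z ->
  setprod (cl I X) Y `<=` cl I Z.
Proof.
move=> XYZ finZ _ [x clx [y Yy <-]]; rewrite -(flat_cl indI finZ) mulC.
apply: cl_sub (translate_cl_sub indG y clx) => _ [x' Xx' <-].
by rewrite mulC; apply: XYZ; exists x' => //; exists y.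
Qed.

(** Dyson's transform replaces the pair (S, R) by (S U eR, R n e^-1 S); the
    closure makes the first component a flat again without changing its rank. *)
Definition dyson_S S R e := cl I (S `|` translate e R).
Definition dyson_R S R e := R `&` translate e^-1 S.

Lemma dyson_setprod S R e : finite_rank I (setprod S R) -> S e ->
  setprod (dyson_S S R e) (dyson_R S R e) `<=` cl I (setprod S R).
Proof.
move=> finSR Se; apply: setprod_cl_sub finSR.
move=> _ [x [Sx|[r Rr <-]] [y [Ry /translateP Sy] <-]]; apply: sub_cl.
  by exists x => //; exists y.
exists (e * y); first by rewrite -{1}(invgK e).
by exists r => //; rewrite mulC mulgA (mulC r).
Qed.

(** Modularity for the flats [S] and [translate e R], because translating
    [dyson_R S R e] by [e] gives their intersection. *)
Lemma dyson_rank S R e : flat I S -> flat I R -> finite_rank I R ->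
  finite_rank I (S `|` translate e R) ->
  cardinal_sum (rank I (dyson_S S R e)) (rank I (dyson_R S R e)) #=
    cardinal_sum (rank I S) (rank I R).
Proof.
move=> flS flR finR finU.
have trR' : translate e (dyson_R S R e) = S `&` translate e R.
  apply/seteqP; split=> x; rewrite translateP.
    by case=> Rx /translateP; rewrite invgK mulVKg => Sx; split=> //; apply/translateP.
  by case=> Sx /translateP Rx; split=> //; apply/translateP; rewrite invgK mulVKg.
have finR' : finite_rank I (dyson_R S R e) by apply: (finite_rank_sub indI) finR => x [].
have modSR := maig_modular modG flS (flat_translate indG e flR).
apply: card_eq_trans (cardinal_sum_congr (card_eqxx _) (rank_translate indG e finR)).
rewrite (card_eqr modSR); apply: cardinal_sum_congr; first exact: rank_cl.
by rewrite -trR'; apply: card_esym; apply: rank_translate.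
Qed.

(** Strong induction on the rank of [R].  As [R'] contains [1], the inclusion
    [setprod S' R' `<=` S'] is an equality, and it holds at once unless some [e]
    in [S] strictly shrinks [R] to [dyson_R S R e]. *)
Lemma dyson_stabilize n S R : flat I S -> flat I R ->
  finite_rank I (setprod S R) -> S !=set0 -> R 1 ->
  rank I R #= `I_n ->
  exists S' R' : set G,
    [/\ flat I S', flat I R', S `<=` S', R' 1 & R' `<=` R] /\
    [/\ setprod S' R' `<=` S', S' `<=` cl I (setprod S R) &
      cardinal_sum (rank I S') (rank I R') #= cardinal_sum (rank I S) (rank I R)].
Proof.
elim/ltn_ind: n S R => n IHn S R flS flR finSR S0 R1 Rn.
have finR : finite_rank I R by exists n.
have SsubSR : S `<=` setprod S R.
  by move=> x Sx; exists x => //; exists 1; rewrite ?mulg1.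
have [SRS|nSRS] := pselect (setprod S R `<=` S).
  by exists S, R; do 2!split=> //; move=> x /SsubSR; apply: sub_cl.
have [e Se [r Rr Ser]] : exists2 e, S e & exists2 r, R r & ~ S (e * r).
  apply: contrapT => noe; apply: nSRS => _ [e Se [r Rr <-]].
  by apply: contrapT => Ser; apply: noe; exists e => //; exists r.
have UsubSR : S `|` translate e R `<=` setprod S R.
  by move=> x [/SsubSR//|[y Ry <-]]; exists e => //; exists y.
have finU := finite_rank_sub indI UsubSR finSR.
set S1 := dyson_S S R e; set R1' := dyson_R S R e.
have R1R : R1' `<=` R by move=> x [].
have prod1 : setprod S1 R1' `<=` cl I (setprod S R) by apply: dyson_setprod.
have flS1 : flat I S1 by apply: flat_cl.
have flR1 : flat I R1'.
  by apply: flatI => //; apply: (flat_translate indG).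
have R11 : R1' 1.
  by split=> //; apply/translateP; rewrite invgK mulg1.
have SS1 : S `<=` S1 by move=> x Sx; apply: sub_cl; left.
have clprod1 : cl I (setprod S1 R1') `<=` cl I (setprod S R).
  by rewrite -[X in _ `<=` X](flat_cl indI finSR); apply: cl_sub.
have [m R1m] : finite_rank I R1' := finite_rank_sub indI R1R finR.
have mn : (m < n)%N.
  apply: (rank_flat_proper indI flR1 R1R _ R1m Rn) => R1E.
  by move: Rr; rewrite -R1E => -[_ /translateP]; rewrite invgK.
have [||S' [R' [[flS' flR' S1S' R'1 R'R1] [prod' S'cl sum']]]] :=
    IHn m mn S1 R1' flS1 flR1 _ _ R11 R1m.
- exact (finite_rank_sub indI prod1 (finite_rank_cl indI finSR)).
- by have [x /SS1] := S0; exists x.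
exists S', R'; split; split=> //.
- exact: subset_trans SS1 S1S'.
- exact: subset_trans R'R1 R1R.
- exact: subset_trans S'cl clprod1.
exact: card_eq_trans sum' (dyson_rank flS flR finR finU).
Qed.

End DysonTransform.

Theorem theorem6p2 (G : groupType) (I : set (set G)) (A S R : set G) :
  modular_abelian_independence_group I ->
  A !=set0 -> S !=set0 -> R !=set0 ->
  flat I A -> flat I S -> flat I R ->
  finite_rank I A -> finite_rank I S -> finite_rank I R ->
  R 1 -> setprod S R `<=` A ->
  exists S' R' : set G,
    [/\ S' !=set0, R' !=set0, flat I S' & flat I R'] /\
    (finite_rank I S' /\ finite_rank I R') /\
    [/\ [/\ S `<=` setprod S' R', setprod S' R' `<=` cl I (setprod S R)
          & cl I (setprod S R) `<=` A],
        R' 1 /\ R' `<=` R,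
        cardinal_sum (rank I S') (rank I R') #= cardinal_sum (rank I S) (rank I R)
      & setprod S' R' = S' /\ S' `<=` A].
Proof.
move=> modG _ S0 _ flA flS flR finA _ finR R1 SRA.
have indI := indep_group_structure (maig_group modG).
have clA : cl I (setprod S R) `<=` A by rewrite -[X in _ `<=` X]flA; apply: cl_sub.
have [n Rn] := finR.
have [S' [R' [[flS' flR' SS' R'1 R'R] [prodS' S'cl sum']]]] :=
  dyson_stabilize modG flS flR (finite_rank_sub indI SRA finA) S0 R1 Rn.
have prodE : setprod S' R' = S'.
  apply/seteqP; split=> // x S'x; exists x => //.
  by exists 1; rewrite ?mulg1.
have S'A : S' `<=` A := subset_trans S'cl clA.
exists S', R'; rewrite prodE; split; last split.
- split=> //; last by exists 1.
  by have [x /SS'] := S0; exists x.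
- by split; [apply: (finite_rank_sub indI) finA | apply: (finite_rank_sub indI) finR].
- by split.
Qed.
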